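(* For any LCL problem on paths, trees, or general graphs, the deterministic mending volume $\mathsf{DMVol}$ is either $\Theta(1)$ or $\Theta(n)$.
   Context: All graphs have maximum degree bounded by a constant. An LCL problem $\Pi=(\Sigma,\mathcal G,\phi)$ consists of a finite label set $\Sigma$, a class $\mathcal G$ of input graphs, and a local verifier $\phi$ of constant radius $r$: $\phi(G,\lambda,v)\in\{\text{happy},\text{unhappy}\}$ depends only on the isomorphism type of the labeled radius-$r$ neighborhood of $v$. A partial solution is a labeling $\lambda:V(G)\to\Sigma\sqcup\{\bot\}$ such that every vertex with no $\bot$ within distance $r$ is happy. A hole is a vertex labeled $\bot$. A mend of $\lambda$ at a hole $v$ is a partial solution $\lambda'$ with $\lambda'(v)\neq\bot$ and $\lambda'(u)\neq\bot$ whenever $\lambda(u)\ne\bot$. Mends are assumed to always exist. A set $W\subseteq V(G)$ contains a mend of $\lambda$ at $v$ if some mend $\lambda'$ of $\lambda$ at $v$ satisfies $\{u:\lambda'(u)\ne\lambda(u)\}\subseteq W$. A (local) mender $\mathcal M$ assigns to each $(G,\lambda,v)$ a Markov chain $\mathcal M_{G,\lambda,v}$ on subsets of $V(G)$ such that: (progress) $\mathcal M_{G,\lambda,v}(W,W')>0$ implies $W\subseteq W'$; (termination) $\mathcal M_{G,\lambda,v}(W,W)=1$ iff $W$ contains a mend of $\lambda$ at $v$; (locality) $\mathcal M_{G,\lambda,v}(W,\cdot)$ depends only on $W$ and its direct neighborhood (in particular not on the size of $G$). In the exploration model only neighbors of already explored vertices can be newly explored, so states reached from $\{v\}$ are connected.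 The chain is absorbing; $\mathcal F=\mathcal F^{\mathcal M}_{G,\lambda,v}(\{v\})$ is the set of absorbing (final) states reachable from $\{v\}$. Then $\mathsf{DMVol}(\mathcal M,G)=\max_{\lambda,v}\max_{W_F\in\mathcal F}|W_F|$ (equivalently, one may restrict to deterministic menders, whose transition probabilities are all $0$ or $1$). $\Pi$ has $\mathsf{DMVol}=O(T)$ if there is a mender $\mathcal M$ with $\mathsf{DMVol}(\mathcal M,G_n)=O(T(n))$ on all instances $G_n\in\mathcal G$ of size $n$; $\Pi$ has $\mathsf{DMVol}=\Omega(T)$ if for every mender $\mathcal M$ there are instances $G_n$ of size $n$ with $\mathsf{DMVol}(\mathcal M,G_n)=\Omega(T(n))$; $\Theta$ means both.
   Formalization: The ''direct neighborhood'' in a mender's locality is the ball of any fixed radius at least max(1,2r), since with radius 1 locality and termination can conflict and no mender exists; trees have degree bound at least 2, so that large instances exist. *)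

(* Defs.v *)
From HB Require Import structures.
From mathcomp Require Import all_boot all_order all_algebra.
From mathcomp Require Import reals.

Set Implicit Arguments.
Unset Strict Implicit.
Unset Printing Implicit Defensive.

Import Order.TTheory GRing.Theory Num.Theory.

Record sgraph := SGraph {
  vertex :> finType;
  adj : rel vertex;
  adj_sym : symmetric adj;
  adj_irrefl : irreflexive adj }.

Definition max_degree_le (D : nat) (G : sgraph) : Prop :=
  forall x : G, #|[set y | adj x y]| <= D.

Definition is_path (G : sgraph) : Prop :=
  0 < #|G| /\
  exists pos : G -> 'I_#|G|, bijective pos /\
    forall x y : G, adj x y =
      (pos y == (pos x).+1 :> nat) || (pos x == (pos y).+1 :> nat).

Definition is_tree (G : sgraph) : Prop :=
  [/\ 0 < #|G|,
      forall x y : G, connect (@adj G) x y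
    & forall c : seq G, 2 < size c -> ~ ucycle (@adj G) c].

(* The constant carried by Trees and Graphs is the degree bound. Members of
   Graphs need not be connected. *)
Inductive graph_class := Paths | Trees of nat | Graphs of nat.

Definition in_class (C : graph_class) (G : sgraph) : Prop :=
  match C with
  | Paths => is_path G
  | Trees D => is_tree G /\ max_degree_le D G
  | Graphs D => max_degree_le D G
  end.

Definition nbhd (G : sgraph) (W : {set G}) : {set G} :=
  W :|: [set y | [exists x in W, adj x y]].

(* The vertices at distance at most k from W. *)
Definition ball (G : sgraph) (k : nat) (W : {set G}) : {set G} :=
  iter k (@nbhd G) W.

(* A (partial) labeling; None is the symbol "bot". *)
Notation labeling S G := {ffun vertex G -> option S}.

(* f restricts to an isomorphism of labeled graphs from the subgraph of G
   induced by A to the subgraph of H induced by B. *)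
Definition labeled_iso (S : finType) (G H : sgraph) (lam : labeling S G)
    (mu : labeling S H) (A : {set G}) (B : {set H}) (f : G -> H) : Prop :=
  [/\ {in A &, injective f},
      f @: A = B,
      {in A &, forall x y, adj (f x) (f y) = adj x y}
    & {in A, forall x, mu (f x) = lam x}].

(* happy is only ever evaluated at vertices whose ball contains no None, so its
   values on other arguments are irrelevant. *)
Record lcl := LCL {
  label : finType;
  class : graph_class;
  radius : nat;
  happy : forall G : sgraph, labeling label G -> G -> bool;
  happy_local : forall (G H : sgraph) (lam : labeling label G)
      (mu : labeling label H) (v : G) (w : H) (f : G -> H),
    in_class class G -> in_class class H ->
    labeled_iso lam mu (ball radius [set v]) (ball radius [set w]) f ->
    f v = w -> happy lam v = happy mu w }.

Section Mending.
Variables (Pi : lcl) (G : sgraph).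
Implicit Types (lam mu : labeling (label Pi) G) (v : G) (W : {set G}).

Definition partial_solution lam : bool :=
  [forall v, [forall u in ball (radius Pi) [set v], lam u != None]
             ==> happy lam v].

Definition hole lam v : bool := lam v == None.

Definition is_mend lam v mu : bool :=
  [&& partial_solution mu, mu v != None
    & [forall u, (lam u != None) ==> (mu u != None)]].

Definition contains_mend lam v W : bool :=
  [exists mu, is_mend lam v mu && ([set u | mu u != lam u] \subset W)].

Definition instance lam v : Prop :=
  [/\ in_class (class Pi) G, partial_solution lam & hole lam v].

End Mending.

Definition mends_exist (Pi : lcl) : Prop :=
  forall (G : sgraph) (lam : labeling (label Pi) G) (v : G),
    instance lam v -> exists mu, is_mend lam v mu.

Local Open Scope ring_scope.

(* trans lam v is the transition matrix of the chain M_{G,lam,v}. Started from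
   [set v] and only growing, it stays among the sets containing v; termination
   and exploration are required of these only, since they contradict each other
   at set0.
   rho is the radius of the neighborhood of W on which the transitions depend.
   Whether W contains a mend is determined by radius 2 * radius Pi but in
   general by no smaller one, so for a smaller rho termination and locality may
   contradict each other. *)
Record mender (R : realType) (Pi : lcl) (rho : nat) := Mender {
  trans : forall G : sgraph, labeling (label Pi) G -> G ->
            {set G} -> {set G} -> R;
  trans_ge0 : forall (G : sgraph) (lam : labeling (label Pi) G) (v : G),
    instance lam v -> forall W W', 0 <= trans lam v W W';
  trans_sum1 : forall (G : sgraph) (lam : labeling (label Pi) G) (v : G),
    instance lam v -> forall W, \sum_(W' : {set G}) trans lam v W W' = 1;
  progress : forall (G : sgraph) (lam : labeling (label Pi) G) (v : G),
    instance lam v ->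
    forall W W', 0 < trans lam v W W' -> W \subset W';
  exploration : forall (G : sgraph) (lam : labeling (label Pi) G) (v : G),
    instance lam v ->
    forall W W' : {set G}, v \in W -> 0 < trans lam v W W' -> W' \subset nbhd W;
  termination : forall (G : sgraph) (lam : labeling (label Pi) G) (v : G),
    instance lam v ->
    forall W : {set G}, v \in W -> (trans lam v W W = 1 <-> contains_mend lam v W);
  locality : forall (G H : sgraph) (lam : labeling (label Pi) G)
      (mu : labeling (label Pi) H) (v : G) (w : H) (f : G -> H)
      (W : {set G}) (X : {set H}),
    instance lam v -> instance mu w -> v \in W ->
    labeled_iso lam mu (ball rho W) (ball rho X) f ->
    f v = w -> f @: W = X ->
    forall W' : {set G}, W' \subset ball rho W ->
      trans lam v W W' = trans mu w X (f @: W') }.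

Section Volume.
Variables (R : realType) (Pi : lcl) (rho : nat).

Definition final_states (M : mender R Pi rho) (G : sgraph)
    (lam : labeling (label Pi) G) (v : G) : {set {set G}} :=
  [set W | connect (fun A B => 0 < trans M lam v A B) [set v] W
           && (trans M lam v W W == 1)].

Definition DMVol (M : mender R Pi rho) (G : sgraph) : nat :=
  \max_(lam : labeling (label Pi) G | partial_solution lam)
    \max_(v | hole lam v) \max_(W in final_states M lam v) #|W|.

Definition DMVol_O (T : nat -> R) : Prop :=
  exists (M : mender R Pi rho) (c : R) (N : nat),
    forall G : sgraph, in_class (class Pi) G -> (N <= #|G|)%N ->
      (DMVol M G)%:R <= c * T #|G|.

Definition DMVol_Omega (T : nat -> R) : Prop :=
  forall M : mender R Pi rho, exists2 c : R, 0 < c & exists N : nat,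
    forall n : nat, (N <= n)%N ->
      exists G : sgraph, [/\ in_class (class Pi) G, #|G| = n
                           & c * T n <= (DMVol M G)%:R].

Definition DMVol_Theta (T : nat -> R) : Prop := DMVol_O T /\ DMVol_Omega T.

End Volume.

(* Main.v *)
Require Import Defs.
From HB Require Import structures.
From mathcomp Require Import all_boot all_order all_algebra.
From mathcomp Require Import boolp reals.
From mathcomp Require Import zify.

Set Implicit Arguments.
Unset Strict Implicit.
Unset Printing Implicit Defensive.

Import Order.TTheory GRing.Theory Num.Theory.

(* A breadth-first mender replaces W by its closed neighborhood until W contains
   a mend. If a ball of some fixed radius k around the hole always contains a
   mend, it stops within that ball, whose size is bounded because degrees are.

   Otherwise, for every n, some instance has no mend in the ball of radius n
   around the hole v. Run an arbitrary mender there and let W be the last state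
   of size at most n / C, where C bounds the growth of a set by a ball of radius
   rho + 1. The step leaving W only sees the ball of radius rho around W.
   Extend the ball of radius rho + 1 to a connected set A of exactly n vertices
   (possible since the component of v has more than n), pass to the induced
   subgraph on A, and turn every vertex outside the ball of radius rho into a
   hole: this is an instance of size n on which the mender has the same run, so
   it explores more than n / C - 1 vertices. Cutting out of one hard graph,
   rather than padding a small one, keeps paths paths and trees trees. *)

(** * Balls and connected sets *)

Section Balls.
Variable G : sgraph.
Implicit Types (x y v : G) (U W A : {set G}) (k : nat).

Lemma nbhdP W y :
  reflect (y \in W \/ exists2 x, x \in W & adj x y) (y \in nbhd W).
Proof.
rewrite !inE; apply: (iffP orP) => [] [yW|]; try by left.
  by move=> /existsP[x /andP[xW xy]]; right; exists x.
by case=> x xW xy; right; apply/existsP; exists x; rewrite xW.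
Qed.

Lemma sub_nbhd W : W \subset nbhd W.
Proof. exact: subsetUl. Qed.

Lemma nbhdS U W : U \subset W -> nbhd U \subset nbhd W.
Proof.
move=> /subsetP sUW; apply/subsetP => y /nbhdP[/sUW yW|[x /sUW xW xy]].
  by apply/nbhdP; left.
by apply/nbhdP; right; exists x.
Qed.

Lemma ballS k U W : U \subset W -> ball k U \subset ball k W.
Proof. by move=> sUW; elim: k => //= k; apply: nbhdS. Qed.

Lemma ballD j k W : ball (j + k) W = ball j (ball k W).
Proof. exact: iterD. Qed.

Lemma sub_ball k W : W \subset ball k W.
Proof. by elim: k => //= k /subset_trans; apply; apply: sub_nbhd. Qed.

Lemma leq_ball j k W : j <= k -> ball j W \subset ball k W.
Proof. by move=> /subnK <-; rewrite ballD sub_ball. Qed.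

Lemma ball_refl k x : x \in ball k [set x].
Proof. by rewrite (subsetP (sub_ball k _)) ?set11. Qed.

Lemma ball_sym k x y : y \in ball k [set x] -> x \in ball k [set y].
Proof.
elim: k y => [|k IHk] y; first by rewrite !inE eq_sym.
rewrite /ball iterS -/(ball k _) => /nbhdP[/IHk|[z /IHk xz zy]].
  exact: (subsetP (leq_ball _ (leqnSn k))).
rewrite iterSr; apply: (subsetP (ballS k _)) xz.
by rewrite sub1set; apply/nbhdP; right; exists y; rewrite ?set11 // adj_sym.
Qed.

Lemma ball_disjoint k W x :
  x \notin ball k W -> {in ball k [set x], forall y, y \notin W}.
Proof.
move=> xW y /ball_sym xy; apply: contra xW => yW.
by apply: (subsetP (ballS k _)) xy; rewrite sub1set.
Qed.

Lemma ball_closed k W : nbhd W = W -> ball k W = W.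
Proof. by move=> clW; elim: k => //= k ->. Qed.

(** The equation [nbhd W = W] says that [W] is a union of connected components; by symmetry of
    adjacency this passes to the complement. *)
Lemma closedC W : nbhd W = W -> nbhd (~: W) = ~: W.
Proof.
move=> clW; apply/eqP; rewrite eqEsubset sub_nbhd andbT.
apply/subsetP => y /nbhdP[//|[x xW xy]]; rewrite inE.
apply: contraL xW => yW; rewrite inE negbK -clW.
by apply/nbhdP; right; exists y; rewrite // adj_sym.
Qed.

Lemma card_nbhd D W : max_degree_le D G -> #|nbhd W| <= D.+1 * #|W|.
Proof.
move=> degG.
have -> : nbhd W = \bigcup_(x in W) (x |: [set y | adj x y]).
  apply/setP => y; apply/nbhdP/bigcupP => [[yW|[x xW xy]]|[x xW]].
  - by exists y; rewrite // !inE eqxx.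
  - by exists x; rewrite // !inE xy orbT.
  - by rewrite !inE => /orP[/eqP->|xy]; [left|right; exists x].
apply: leq_trans (_ : \sum_(x in W) D.+1 <= _); last first.
  by rewrite sum_nat_const mulnC.
apply: (@leq_trans (\sum_(x in W) #|x |: [set y | adj x y]|)); last first.
  apply: leq_sum => x _; rewrite cardsU1 -add1n; apply: leq_add (degG x).
  by case: (_ \notin _).
elim/big_rec2: _ => [|x m U _ leUm]; first by rewrite cards0.
by apply: leq_trans (leq_card_setU _ _) _; rewrite leq_add2l.
Qed.

Lemma card_ball D k W : max_degree_le D G -> #|ball k W| <= D.+1 ^ k * #|W|.
Proof.
move=> degG; elim: k => [|k IHk]; first by rewrite mul1n.
apply: leq_trans (card_nbhd _ degG) _.
by rewrite expnS -mulnA leq_mul2l IHk.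
Qed.

(* The connected sets containing v, presented by the way an exploration from v
   reaches them. *)
Inductive grown v : {set G} -> Prop :=
| grown1 : grown v [set v]
| grownS U W : grown v U -> U \subset W -> W \subset nbhd U -> grown v W.

Lemma grown_ball v k W : grown v W -> grown v (ball k W).
Proof.
by move=> gW; elim: k => //= k gk; apply: grownS gk (sub_nbhd _) (subxx _).
Qed.

Lemma grown_mem v W : grown v W -> v \in W.
Proof.
by elim=> [|U A _ vU /subsetP sUA _]; [rewrite set11 | apply: sUA].
Qed.

(** Each step that enlarges the set adds at least one vertex but reaches at most one edge
    further. *)
Lemma grown_sub_ball v W : grown v W -> W \subset ball #|W| [set v].
Proof.
elim=> [|U A _ IHU sUA sAU]; first exact: sub_ball.
have := sUA; rewrite subEproper => /predU1P[<- //|ltUA].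
apply: subset_trans sAU _; apply: subset_trans (nbhdS IHU) _.
exact: leq_ball (proper_card ltUA).
Qed.

(** Boundary vertices are added one at a time, so the target size is hit exactly; the first
    hypothesis supplies one as long as fewer than [n] vertices are present. *)
Lemma grown_extend v n W :
    (forall U, grown v U -> #|U| < n -> nbhd U != U) ->
    grown v W -> #|W| <= n ->
  exists2 A, grown v A & W \subset A /\ #|A| = n.
Proof.
move=> open; have [m] := ubnP (n - #|W|).
elim: m W => // m IHm W lt_m gW leWn.
have [lenW|ltWn] := leqP n #|W|.
  by exists W => //; split=> //; apply/eqP; rewrite eqn_leq leWn.
have /subsetPn[y yW' yW]: ~~ (nbhd W \subset W).
  by have := open _ gW ltWn; rewrite eqEsubset sub_nbhd andbT.
have cardU: #|y |: W| = #|W|.+1 by rewrite cardsU1 yW.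
have gU: grown v (y |: W).
  apply: grownS gW (subsetUr _ _) _.
  by rewrite subUset sub1set yW' sub_nbhd.
have [|//||A gA [sUA cA]] := IHm (y |: W).
- by rewrite cardU subnS prednK ?subn_gt0.
- by rewrite cardU.
- by exists A => //; split=> //; apply: subset_trans sUA; apply: subsetUr.
Qed.

End Balls.

Definition degree_bound (C : graph_class) : nat :=
  match C with Paths => 2 | Trees D => D | Graphs D => D end.

Lemma in_class_degree C (G : sgraph) :
  in_class C G -> max_degree_le (degree_bound C) G.
Proof.
case: C => [|D|D] /=; [|by case|by []].
move=> [_ [pos [bij_pos adjE]]] x.
have inj_pos := bij_inj bij_pos.
rewrite -(card_imset _ inj_pos).
set N := pos @: _.
(* At [pos x = 0] the predecessor is again 0, which is harmless: only a two-element list covering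
   the neighbors' positions is needed. *)
have sN: {subset [seq val i | i in N] <= [:: (pos x).-1; (pos x).+1]}.
  move=> j /mapP[i]; rewrite mem_enum => /imsetP[y]; rewrite inE adjE => xy -> ->.
  by rewrite !inE /=; case/orP: xy => /eqP ->; rewrite ?eqxx ?orbT.
rewrite -(size_image val); apply: uniq_leq_size sN.
by rewrite map_inj_uniq ?enum_uniq //; apply: val_inj.
Qed.

(** * Induced subgraphs on connected sets *)

Section Induced.
Variables (G : sgraph) (A : {set G}).

Definition induced_adj : rel {x | x \in A} := relpre val (@adj G).

Fact induced_adj_sym : symmetric induced_adj.
Proof. by move=> x y; apply: adj_sym. Qed.

Fact induced_adj_irrefl : irreflexive induced_adj.
Proof. by move=> x; apply: adj_irrefl. Qed.

Definition induced : sgraph := SGraph induced_adj_sym induced_adj_irrefl.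

Definition incl (x : induced) : G := val x.

Lemma incl_inj : injective incl.
Proof. exact: val_inj. Qed.

Lemma incl_mem x : incl x \in A.
Proof. exact: valP x. Qed.

Lemma adj_incl x y : adj (incl x) (incl y) = adj x y.
Proof. by []. Qed.

Lemma inclP y : reflect (exists x, y = incl x) (y \in A).
Proof.
by apply: (iffP idP) => [yA|[x ->]]; [exists (Sub y yA)|apply: incl_mem].
Qed.

Lemma card_induced : #|induced| = #|A|.
Proof. by rewrite card_sig; apply: eq_card. Qed.

Lemma incl_preimset (U : {set G}) : U \subset A -> incl @: (incl @^-1: U) = U.
Proof.
move=> /subsetP sUA; apply/setP => y; apply/imsetP/idP => [[x]|yU].
  by rewrite inE => xU ->.
by have /inclP[x xy] := sUA y yU; exists x; rewrite // inE -xy.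
Qed.

Lemma incl_nbhd (U : {set induced}) : incl @: nbhd U = nbhd (incl @: U) :&: A.
Proof.
apply/setP => y; rewrite inE andbC; case: inclP => [[{}y ->]|yA]; last first.
  by apply/negP => /imsetP[x _ yx]; case: yA; exists x.
rewrite (mem_imset _ _ incl_inj).
apply/nbhdP/nbhdP => -[yU|[x xU xy]].
- by left; apply: imset_f.
- by right; exists (incl x); rewrite ?imset_f.
- by left; rewrite (mem_imset _ _ incl_inj) in yU.
- case/imsetP: xU xy => {}x xU ->; rewrite adj_incl => xy.
  by right; exists x.
Qed.

Lemma incl_ball_sub k (U : {set induced}) :
  incl @: ball k U \subset ball k (incl @: U).
Proof.
elim: k => //= k IHk; rewrite incl_nbhd.
exact: subset_trans (subsetIl _ _) (nbhdS IHk).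
Qed.

(** Passing to [induced A] can lengthen distances, but the balls agree when no vertex of the ball
    has a neighbor outside [A]. *)
Lemma incl_ball k (U : {set induced}) :
    (forall x, x \in ball k U -> nbhd [set incl x] \subset A) ->
  incl @: ball k U = ball k (incl @: U).
Proof.
elim: k => // k IHk nbA; rewrite [ball _ _]iterS incl_nbhd -/(ball k U).
have {}IHk: incl @: ball k U = ball k (incl @: U).
  by apply: IHk => x xk; apply: nbA; apply: subsetP (leq_ball _ (leqnSn k)) _ xk.
rewrite [RHS]iterS -/(ball k _) -IHk; apply/setIidPl/subsetP => y.
case/nbhdP=> [/imsetP[x _ ->]|[_ /imsetP[x xk ->] xy]]; first exact: incl_mem.
apply: (subsetP (nbA x (subsetP (leq_ball _ (leqnSn k)) _ xk))).
by apply/nbhdP; right; exists (incl x); rewrite ?set11.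
Qed.

Lemma induced_degree D : max_degree_le D G -> max_degree_le D induced.
Proof.
move=> degG x; apply: leq_trans (degG (incl x)).
rewrite -(card_imset _ incl_inj); apply/subset_leq_card/subsetP.
by move=> z /imsetP[y]; rewrite inE => xy ->; rewrite inE.
Qed.

Lemma induced_connect (v : induced) :
  grown (incl v) A -> forall x : induced, connect (@adj induced) v x.
Proof.
move=> gA.
(* The induction runs over the stages of growth of [A]; all of them lie in [A], so the connecting
   edges survive in [induced A]. *)
suff gen U : grown (incl v) U -> U \subset A ->
    forall x : induced, incl x \in U -> connect (@adj induced) v x.
  by move=> x; apply: gen gA _ _ _; rewrite ?incl_mem.
elim=> [_ x|{}U W _ IHU sUW sWU sWA x /(subsetP sWU)/nbhdP].
  by rewrite inE => /eqP/incl_inj->.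
have sUA := subset_trans sUW sWA.
case=> [|[y yU yx]]; first exact: IHU x.
have /inclP[z defy] := subsetP sUA y yU; rewrite defy in yU yx.
by apply: connect_trans (IHU sUA z yU) (connect1 _).
Qed.

Lemma induced_tree v : grown v A -> is_tree G -> is_tree induced.
Proof.
move=> gA [_ _ acyG]; have /inclP[u defv] := grown_mem gA.
rewrite defv in gA; split=> [|x y|c szc /andP[cyc uc]].
- by apply/card_gt0P; exists u.
- apply: (@connect_trans _ _ u); last exact: induced_connect.
  rewrite sym_connect_sym; first exact: induced_connect.
  exact: adj_sym.
- apply: (acyG (map incl c)); first by rewrite size_map.
  apply/andP; split; last by rewrite map_inj_uniq //; apply: incl_inj.
  by rewrite cycle_map.
Qed.

End Induced.

(** Connected sets of a path are intervals, because one growth step adds at most one position at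
    either end. *)
Lemma grown_interval (G : sgraph) (pos : G -> 'I_#|G|) (v : G) (A : {set G}) :
    injective pos ->
    (forall x y : G, adj x y =
      (pos y == (pos x).+1 :> nat) || (pos x == (pos y).+1 :> nat)) ->
    grown v A ->
  exists a b, forall x, (x \in A) = (a <= pos x <= b).
Proof.
move=> inj_pos adjE; elim=> [|U W _ [a [b defU]] /subsetP sUW /subsetP sWU].
  exists (pos v), (pos v) => x.
  by rewrite inE -eqn_leq eq_sym -(inj_eq inj_pos).
have bndW x : x \in W -> a <= (pos x).+1 /\ pos x <= b.+1.
  move=> /sWU/nbhdP[|[y]]; rewrite defU; first lia.
  by rewrite adjE => /andP[? ?] /orP[/eqP|/eqP]; lia.
(* [below] and [above] count, as 0 or 1, the position gained at each end. The truncated [a - below]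
   is exact, since [below] can hold only for positive [a]. *)
pose below := [exists x in W, pos x < a].
pose above := [exists x in W, b < pos x].
exists (a - below), (b + above) => x; apply/idP/idP => [xW|].
  have [? ?] := bndW x xW; apply/andP; split.
    have [|] := leqP a (pos x); first lia.
    move=> ltxa; rewrite (_ : below = true); first lia.
    by apply/existsP; exists x; rewrite xW.
  have [|] := leqP (pos x) b; first lia.
  move=> ltxb; rewrite (_ : above = true); first lia.
  by apply/existsP; exists x; rewrite xW.
case/andP=> lea leb.
(* A new position is [a - 1] or [b + 1], and the witness of [below] or [above] sits there too, so
   injectivity of [pos] identifies the two vertices. *)
have [ltxa|leax] := ltnP (pos x) a.
  have /existsP[y /andP[yW ltya]]: below by case: (below) lea => //; lia.
  have [? _] := bndW y yW.
  by rewrite (_ : x = y) //; apply/inj_pos/ord_inj; have := leq_b1 below; lia.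
have [ltbx|lexb] := ltnP b (pos x).
  have /existsP[y /andP[yW ltyb]]: above by case: (above) leb => //; lia.
  have [_ ?] := bndW y yW.
  by rewrite (_ : x = y) //; apply/inj_pos/ord_inj; have := leq_b1 above; lia.
by apply: sUW; rewrite defU leax.
Qed.

Lemma induced_path (G : sgraph) (v : G) (A : {set G}) :
  grown v A -> is_path G -> is_path (induced A).
Proof.
move=> gA [_ [pos [[inv posK invK] adjE]]].
have inj_pos := can_inj posK.
have [a [b defA]] := grown_interval inj_pos adjE gA.
(* Positions are shifted to start at 0. All positions from [a] up to that of [x] belong to vertices
   of [A], so there are at most [#|A|] of them. *)
have ltA (x : induced A) : pos (incl x) - a < #|induced A|.
  rewrite card_induced.
  have : {subset iota a (pos (incl x) - a).+1 <= [seq val (pos y) | y in A]}.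
    have := incl_mem x; rewrite defA => /andP[? ?] j; rewrite mem_iota => lej.
    have ltj : j < #|G| by have := ltn_ord (pos (incl x)); lia.
    apply/mapP; exists (inv (Ordinal ltj)); last by rewrite invK.
    by rewrite mem_enum defA invK /=; lia.
  by move/(uniq_leq_size (iota_uniq _ _)); rewrite size_iota size_map -cardE.
pose posA x := Ordinal (ltA x).
have leaA (x : induced A) : a <= pos (incl x).
  by have := incl_mem x; rewrite defA => /andP[].
split.
  by rewrite card_induced; apply/card_gt0P; exists v; apply: grown_mem.
exists posA; split.
  apply: inj_card_bij; last by rewrite card_ord.
  move=> x y /(congr1 val) /= eqxy; apply/incl_inj/inj_pos/ord_inj.
  by rewrite -(subnK (leaA x)) -(subnK (leaA y)) eqxy.
move=> x y; rewrite -adj_incl adjE /=.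
rewrite -[in RHS](eqn_add2r a) -[X in _ = _ || X](eqn_add2r a).
by rewrite !addSn !subnK.
Qed.

Lemma in_class_induced C (G : sgraph) (v : G) (A : {set G}) :
  grown v A -> in_class C G -> in_class C (induced A).
Proof.
move=> gA; case: C => [|D|D] /=; first exact: induced_path gA.
  by case=> treeG degG; split; [apply: induced_tree gA treeG|apply: induced_degree].
exact: induced_degree.
Qed.

(** * Labeled isomorphisms between balls *)

Section LabeledIso.
Variables (S : finType) (G H : sgraph) (lam : labeling S G) (mu : labeling S H).
Variables (n : nat) (W : {set G}) (X : {set H}) (f : G -> H).
Hypotheses (isof : labeled_iso lam mu (ball n W) (ball n X) f) (fW : f @: W = X).

(** [f] is controlled only on [ball n W]; the second inclusion ensures that a neighbor of an image
    vertex has a preimage there. *)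
Lemma iso_nbhd (U : {set G}) :
    nbhd U \subset ball n W -> nbhd (f @: U) \subset ball n X ->
  f @: nbhd U = nbhd (f @: U).
Proof.
case: isof => injf imf adjf _ sU sfU.
have sUn := subsetP (subset_trans (sub_nbhd U) sU).
apply/setP => y; apply/imsetP/idP => [[x xU ->]|yU].
  have /nbhdP[xU'|[z zU zx]] := xU; apply/nbhdP; first by left; apply: imset_f.
  by right; exists (f z); rewrite ?imset_f // adjf // ?(subsetP sU x) // sUn.
have := subsetP sfU y yU; rewrite -imf => /imsetP[x xn defy].
case/nbhdP: yU => [/imsetP[z zU ->]|[_ /imsetP[z zU ->] zy]].
  by exists z; rewrite // (subsetP (sub_nbhd _)).
exists x => //; apply/nbhdP; right; exists z => //.
by rewrite -adjf // -?defy // sUn.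
Qed.

Lemma iso_ball k (U : {set G}) :
    ball k U \subset ball n W -> ball k (f @: U) \subset ball n X ->
  f @: ball k U = ball k (f @: U).
Proof.
elim: k => // k IHk sU sfU; rewrite [ball _ _]iterS [RHS]iterS -!/(ball k _).
have {}IHk : f @: ball k U = ball k (f @: U).
  by apply: IHk; [apply: subset_trans sU|apply: subset_trans sfU];
     apply: sub_nbhd.
by rewrite iso_nbhd ?IHk.
Qed.

Lemma iso_ball1 j k x : j + k <= n -> x \in ball j W ->
  [/\ ball k [set x] \subset ball n W, ball k [set f x] \subset ball n X
    & f @: ball k [set x] = ball k [set f x]].
Proof.
move=> lejk xj.
have sx : ball k [set x] \subset ball n W.
  apply: subset_trans (leq_ball _ lejk); rewrite addnC ballD.
  by apply: ballS; rewrite sub1set.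
have lejn : j <= n by apply: leq_trans lejk; apply: leq_addr.
have fj : f @: ball j W = ball j X.
  by rewrite -fW iso_ball ?fW //; apply: leq_ball.
have sfx : ball k [set f x] \subset ball n X.
  apply: subset_trans (leq_ball _ lejk); rewrite addnC ballD.
  by apply: ballS; rewrite sub1set -fj imset_f.
by split=> //; rewrite -imset_set1 iso_ball // imset_set1.
Qed.

(** [f] is injective only on the ball, so the inverse picks a preimage there and takes the default
    value [v] elsewhere. It allows transfer along [f] to be read backwards. *)
Lemma labeled_iso_inv v : exists g : H -> G,
  [/\ labeled_iso mu lam (ball n X) (ball n W) g, g @: X = W,
      {in ball n W, cancel f g} & (v \in W -> g (f v) = v)].
Proof.
case: isof => injf imf adjf labf.
pose g y := odflt v [pick x in ball n W | f x == y].
have fK : {in ball n W, cancel f g}.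
  move=> x xn; rewrite /g; case: pickP => [z /andP[zn /eqP eqf]|/(_ x)].
    exact: injf.
  by rewrite xn eqxx.
exists g; split=> //; last by move=> vW; apply/fK/(subsetP (sub_ball _ _)).
  split=> [y z||y z|y]; rewrite -?imf.
  - by move=> /imsetP[y' yn ->] /imsetP[z' zn ->]; rewrite !fK // => ->.
  - rewrite -imset_comp -[RHS]imset_id; apply: eq_in_imset => x xn /=; exact: fK.
  - by move=> /imsetP[y' yn ->] /imsetP[z' zn ->]; rewrite !fK // adjf.
  - by move=> /imsetP[y' yn ->]; rewrite fK // labf.
rewrite -fW -imset_comp -[RHS]imset_id; apply: eq_in_imset => x xn /=.
exact/fK/(subsetP (sub_ball _ _)).
Qed.

End LabeledIso.

(** * Mends and the breadth-first mender *)

Section Mends.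
Variable Pi : lcl.
Implicit Types G H : sgraph.

Lemma partial_solutionP G (lam : labeling (label Pi) G) :
  reflect (forall v, {in ball (radius Pi) [set v], forall u, lam u != None} ->
             happy lam v)
          (partial_solution lam).
Proof.
apply: (iffP forallP) => [sol v def|sol v].
  by apply: (implyP (sol v)); apply/forall_inP.
by apply/implyP => /forall_inP; apply: sol.
Qed.

Lemma eq_happy G (lam mu : labeling (label Pi) G) (v : G) :
    in_class (class Pi) G -> {in ball (radius Pi) [set v], lam =1 mu} ->
  happy lam v = happy mu v.
Proof.
move=> inG eqlam; apply: (@happy_local Pi G G lam mu v v id) => //; split=> //.
  exact: imset_id.
by move=> x /eqlam.
Qed.

Lemma contains_mendS G (lam : labeling (label Pi) G) (v : G) (U W : {set G}) :
  U \subset W -> contains_mend lam v U -> contains_mend lam v W.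
Proof.
move=> sUW /existsP[mu /andP[mend sU]]; apply/existsP; exists mu.
by rewrite mend (subset_trans sU).
Qed.

(** Follow any mend on [W] and keep [lam] elsewhere: every ball around a single vertex lies wholly
    inside or wholly outside [W], so no vertex sees a mixture. *)
Lemma contains_mend_closed G (lam : labeling (label Pi) G) (v : G) (W : {set G}) :
    mends_exist Pi -> instance lam v -> v \in W -> nbhd W = W ->
  contains_mend lam v W.
Proof.
move=> hmend inst vW clW; have [inG sol _] := inst.
have [mu /and3P[/partial_solutionP solmu muv /forallP mulam]] := hmend _ _ _ inst.
pose nu := [ffun u => if u \in W then mu u else lam u].
have sub_closed (U : {set G}) u k : nbhd U = U -> u \in U ->
    {subset ball k [set u] <= U}.
  move=> clU uU x; rewrite -(ball_closed k clU); apply: subsetP.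
  by apply: ballS; rewrite sub1set.
apply/existsP; exists nu; apply/andP; split; last first.
  by apply/subsetP => u; rewrite inE ffunE; case: ifP => // _; rewrite eqxx.
apply/and3P; split; last 2 first.
- by rewrite ffunE vW.
- apply/forallP => u; apply/implyP => lamu; rewrite ffunE; case: ifP => // _.
  exact: implyP lamu.
apply/partial_solutionP => u defu; have [uW|uW] := boolP (u \in W).
  have eqnu : {in ball (radius Pi) [set u], nu =1 mu}.
    by move=> x /(sub_closed W)-/(_ clW uW) xW; rewrite ffunE xW.
  by rewrite (eq_happy inG eqnu) solmu // => x xu; rewrite -eqnu // defu.
have eqnu : {in ball (radius Pi) [set u], nu =1 lam}.
  move=> x /(sub_closed (~: W)); rewrite closedC // !inE => /(_ erefl uW) xW.
  by rewrite ffunE (negPf xW).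
rewrite (eq_happy inG eqnu); move/partial_solutionP: sol; apply=> x xu.
by rewrite -eqnu // defu.
Qed.

(** A mend [nu] within [W] is carried over to [X] by [f], and [mu] is kept outside [X]. Only
    vertices within [radius Pi] of [X] can notice, and their own balls stay within [2 * radius Pi]
    of [X], where [f] is an isomorphism. *)
Lemma contains_mend_transfer rho G H (lam : labeling (label Pi) G)
    (mu : labeling (label Pi) H) (W : {set G}) (X : {set H}) (v : G) f :
    2 * radius Pi <= rho -> instance lam v -> in_class (class Pi) H ->
    partial_solution mu -> labeled_iso lam mu (ball rho W) (ball rho X) f ->
    f @: W = X -> v \in W ->
  contains_mend lam v W -> contains_mend mu (f v) X.
Proof.
move=> hrho [inG _ _] inH /partial_solutionP solmu isof fW vW.
move=> /existsP[nu /andP[/and3P[/partial_solutionP solnu nuv nulam] snu]].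
have [g [isog gX fK gfv]] := labeled_iso_inv isof fW v.
have [injf imf adjf labf] := isof.
have nu_out x : x \notin W -> nu x = lam x.
  by apply: contraNeq => xW; apply: (subsetP snu); rewrite inE.
have memW x : x \in ball rho W -> (f x \in X) = (x \in W).
  move=> xn; rewrite -fW; apply/imsetP/idP => [[z zW eqf]|xW]; last by exists x.
  by rewrite (injf x z) //; apply: (subsetP (sub_ball _ _)).
pose xi := [ffun y => if y \in X then nu (g y) else mu y].
have xif x : x \in ball rho W -> xi (f x) = nu x.
  move=> xn; rewrite ffunE memW // fK //; case: ifPn => // xW.
  by rewrite labf ?nu_out.
apply/existsP; exists xi; apply/andP; split; last first.
  by apply/subsetP => y; rewrite inE ffunE; case: ifP => // _; rewrite eqxx.
apply/and3P; split; last 2 first.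
- by rewrite xif // (subsetP (sub_ball _ _)).
- apply/forallP => y; apply/implyP => muy; rewrite ffunE; case: ifP => // yX.
  move: yX muy; rewrite -fW => /imsetP[x xW ->].
  have xn := subsetP (sub_ball rho W) x xW.
  by rewrite labf // fK //; apply: implyP (forallP nulam x).
apply/partial_solutionP => y defy.
have [yX|yX] := boolP (y \in ball (radius Pi) X); last first.
  have eqxi : {in ball (radius Pi) [set y], xi =1 mu}.
    by move=> z /(ball_disjoint yX) zX; rewrite ffunE (negPf zX).
  by rewrite (eq_happy inH eqxi) solmu // => z zy; rewrite -eqxi // defy.
have ler : radius Pi <= rho by lia.
have fr : f @: ball (radius Pi) W = ball (radius Pi) X.
  by rewrite -fW (iso_ball isof) ?fW //; apply: leq_ball.
move: yX defy; rewrite -fr => /imsetP[x xr ->] defy.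
have le2 : radius Pi + radius Pi <= rho by lia.
have [sx sfx fx] := iso_ball1 isof fW le2 xr.
have isox : labeled_iso nu xi (ball (radius Pi) [set x])
    (ball (radius Pi) [set f x]) f.
  split=> [z t /(subsetP sx) zn /(subsetP sx) tn||z t|z /(subsetP sx) zn //].
  - exact: injf.
  - exact: fx.
  - by move=> /(subsetP sx) zn /(subsetP sx) tn; apply: adjf.
  - exact: xif.
rewrite -(happy_local inG inH isox erefl); apply: solnu => z zx.
by rewrite -xif ?(subsetP sx) // defy // -fx imset_f.
Qed.

Lemma contains_mend_iso rho G H (lam : labeling (label Pi) G)
    (mu : labeling (label Pi) H) (W : {set G}) (X : {set H}) (v : G) f :
    2 * radius Pi <= rho -> instance lam v -> instance mu (f v) ->
    labeled_iso lam mu (ball rho W) (ball rho X) f -> f @: W = X -> v \in W ->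
  contains_mend lam v W = contains_mend mu (f v) X.
Proof.
move=> hrho inst inst' isof fW vW; have [[inG sol _] [inH sol' _]] := (inst, inst').
have [g [isog gX _ gfv]] := labeled_iso_inv isof fW v.
apply/idP/idP; first exact: contains_mend_transfer isof fW vW.
rewrite -{2}(gfv vW); apply: contains_mend_transfer isog gX _ => //.
by rewrite -fW imset_f.
Qed.

End Mends.

Local Open Scope ring_scope.

Section BfsMender.
Variables (R : realType) (Pi : lcl) (rho : nat).
Hypotheses (hmend : mends_exist Pi).
Hypotheses (hrho1 : (1 <= rho)%N) (hrho : (2 * radius Pi <= rho)%N).

Definition bfs_step (G : sgraph) (lam : labeling (label Pi) G) (v : G)
    (W : {set G}) : {set G} :=
  if contains_mend lam v W then W else nbhd W.

Definition bfs_trans (G : sgraph) (lam : labeling (label Pi) G) (v : G)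
    (W W' : {set G}) : R := (W' == bfs_step lam v W)%:R.

Lemma bfs_trans_gt0 (G : sgraph) (lam : labeling (label Pi) G) (v : G)
    (W W' : {set G}) :
  (0 < bfs_trans lam v W W') = (W' == bfs_step lam v W).
Proof. by rewrite /bfs_trans; case: eqP; rewrite ?ltr01 ?ltxx. Qed.

Fact bfs_ge0 (G : sgraph) (lam : labeling (label Pi) G) (v : G) :
  instance lam v -> forall W W', 0 <= bfs_trans lam v W W'.
Proof. by move=> _ W W'; apply: ler0n. Qed.

Fact bfs_sum1 (G : sgraph) (lam : labeling (label Pi) G) (v : G) :
  instance lam v -> forall W, \sum_(W' : {set G}) bfs_trans lam v W W' = 1.
Proof.
move=> _ W; rewrite (bigD1 (bfs_step lam v W)) //= /bfs_trans eqxx.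
by rewrite big1 ?addr0 // => W' /negPf ->.
Qed.

Fact bfs_progress (G : sgraph) (lam : labeling (label Pi) G) (v : G) :
  instance lam v ->
  forall W W', 0 < bfs_trans lam v W W' -> W \subset W'.
Proof.
move=> _ W W'; rewrite bfs_trans_gt0 => /eqP ->; rewrite /bfs_step.
by case: ifP => // _; apply: sub_nbhd.
Qed.

Fact bfs_exploration (G : sgraph) (lam : labeling (label Pi) G) (v : G) :
  instance lam v ->
  forall W W' : {set G}, v \in W -> 0 < bfs_trans lam v W W' -> W' \subset nbhd W.
Proof.
move=> _ W W' _; rewrite bfs_trans_gt0 => /eqP ->; rewrite /bfs_step.
by case: ifP => // _; apply: sub_nbhd.
Qed.

(** Standing still without a mend would mean [nbhd W = W], and such a set contains a mend. *)
Fact bfs_termination (G : sgraph) (lam : labeling (label Pi) G) (v : G) :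
  instance lam v ->
  forall W : {set G}, v \in W ->
    (bfs_trans lam v W W = 1 <-> contains_mend lam v W).
Proof.
move=> inst W vW; rewrite /bfs_trans /bfs_step; case: ifPn => [_|nomend].
  by rewrite eqxx.
split=> // /eqP; rewrite (_ : 1 = 1%:R) // eqr_nat eqb1 => /eqP clW.
by rewrite (contains_mend_closed hmend inst vW (esym clW)) in nomend.
Qed.

(** The step is determined by whether [W] contains a mend, visible at radius [2 * radius Pi], and by
    [nbhd W], visible at radius 1. *)
Fact bfs_locality (G H : sgraph) (lam : labeling (label Pi) G)
    (mu : labeling (label Pi) H) (v : G) (w : H) (f : G -> H)
    (W : {set G}) (X : {set H}) :
  instance lam v -> instance mu w -> v \in W ->
  labeled_iso lam mu (ball rho W) (ball rho X) f ->
  f v = w -> f @: W = X ->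
  forall W' : {set G}, W' \subset ball rho W ->
    bfs_trans lam v W W' = bfs_trans mu w X (f @: W').
Proof.
move=> inst inst' vW isof fv fW W' sW'; rewrite -fv in inst' *.
rewrite /bfs_trans /bfs_step -(contains_mend_iso hrho inst inst' isof fW vW).
have sn : nbhd W \subset ball rho W := leq_ball W hrho1.
have sfn : nbhd X \subset ball rho X := leq_ball X hrho1.
have fn : f @: nbhd W = nbhd X by rewrite (iso_nbhd isof) ?fW.
(* [f] need not be injective globally, so equal images give equal sets only for subsets of the
   ball. *)
have inj_im (U : {set G}) :
    U \subset ball rho W -> (f @: W' == f @: U) = (W' == U).
  have [injf _ _ _] := isof.
  move=> sU; apply/eqP/eqP => [eqf|-> //]; apply/setP => x; apply/idP/idP => xW.
    have : f x \in f @: U by rewrite -eqf imset_f.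
    by case/imsetP=> y yU /injf ->; rewrite ?(subsetP sW' x) ?(subsetP sU y).
  have : f x \in f @: W' by rewrite eqf imset_f.
  by case/imsetP=> y yU /injf ->; rewrite ?(subsetP sU x) ?(subsetP sW' y).
by case: ifP => _; rewrite -?fn -?fW inj_im // sub_ball.
Qed.

Definition bfs_mender : mender R Pi rho :=
  Mender bfs_ge0 bfs_sum1 bfs_progress bfs_exploration bfs_termination
    bfs_locality.

End BfsMender.

(** * Runs of a mender *)

Section Runs.
Variables (R : realType) (Pi : lcl) (rho : nat) (M : mender R Pi rho).
Variables (G : sgraph) (lam : labeling (label Pi) G) (v : G).
Hypothesis inst : instance lam v.
Implicit Types U W F : {set G}.

Definition moves : rel {set G} := fun U W => 0 < trans M lam v U W.

Lemma moves_sub U W : connect moves U W -> U \subset W.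
Proof.
case/connectP=> p; elim: p U => [U _ -> //|V p IHp U] /= /andP[UV pV] defW.
exact: subset_trans (progress inst UV) (IHp _ pV defW).
Qed.

Lemma moves_grown U W : connect moves U W -> grown v U -> grown v W.
Proof.
case/connectP=> p; elim: p U => [U _ -> //|V p IHp U] /= /andP[UV pV] defW gU.
apply: IHp pV defW _; apply: (grownS gU (progress inst UV)).
exact: (exploration inst (grown_mem gU) UV).
Qed.

(** The row of [W] sums to 1, so if all off-diagonal entries vanished the diagonal one would be
    1. *)
Lemma moves_exit W :
  v \in W -> trans M lam v W W != 1 -> exists2 F, moves W F & W \proper F.
Proof.
move=> vW nabs; have [/existsP[F /andP[neF WF]]|stay] :=
  boolP [exists F, (F != W) && moves W F].
  by exists F => //; rewrite properEneq eq_sym neF (progress inst WF).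
case/eqP: nabs; rewrite -[RHS](trans_sum1 M inst W) (bigD1 W) //= big1 ?addr0 //.
move=> F neF; apply/eqP; rewrite eq_le trans_ge0 // andbT leNgt.
by apply: contra stay => WF; apply/existsP; exists F; rewrite neF.
Qed.

(** A reachable state of maximal size is absorbing, since [moves_exit] would otherwise lead to a
    larger one. *)
Lemma moves_absorbed W :
  v \in W -> exists2 F, connect moves W F & trans M lam v F F = 1.
Proof.
move=> vW; case: (@arg_maxnP _ W (connect moves W) (fun F => #|F|)) => //.
move=> F WF maxF; exists F => //; apply/eqP; apply: contraT => nabs.
have vF := subsetP (moves_sub WF) v vW.
have [F' FF' /proper_card] := moves_exit vF nabs.
by rewrite ltnNge => /negP[]; exact: maxF (connect_trans WF (connect1 FF')).
Qed.

(** [DMVol] looks at absorbing states only, but every reachable state lies inside a reachable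
    absorbing one. *)
Lemma leq_DMVol W : connect moves [set v] W -> (#|W| <= DMVol M G)%N.
Proof.
move=> vW; have vW' := subsetP (moves_sub vW) v (set11 v).
have [F WF absF] := moves_absorbed vW'; have [_ sol hv] := inst.
apply: leq_trans (subset_leq_card (moves_sub WF)) _.
have finF : F \in final_states M lam v.
  by rewrite inE absF eqxx (connect_trans vW WF).
apply: leq_trans (leq_bigmax_cond lam sol); apply: leq_trans (leq_bigmax_cond v hv).
exact: (leq_bigmax_cond F).
Qed.

(** Choose [W] of maximal size among the reachable states with at most [k] vertices. Lacking a mend,
    it is not absorbing, and by maximality a strictly larger successor exceeds [k]. *)
Lemma moves_cross k :
    (0 < k)%N ->
    (forall W, grown v W -> (#|W| <= k)%N -> ~~ contains_mend lam v W) ->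
  exists W W', [/\ connect moves [set v] W, (#|W| <= k)%N, moves W W'
                 & (k < #|W'|)%N].
Proof.
move=> k_gt0 hard.
pose P W := connect moves [set v] W && (#|W| <= k)%N.
have Pv : P [set v] by rewrite /P connect0 cards1.
case: (arg_maxnP (fun W => #|W|) Pv) => W /andP[vW leWk] maxW.
have gW := moves_grown vW (grown1 v); have vinW := grown_mem gW.
have nabs : trans M lam v W W != 1.
  by apply: contra (hard W gW leWk) => /eqP/(termination M inst vinW).
have [W' WW' /proper_card ltWW'] := moves_exit vinW nabs.
exists W, W'; split=> //; rewrite ltnNge; apply: contraL ltWW' => leW'k.
by rewrite -leqNgt; apply: maxW; rewrite /P leW'k (connect_trans vW) ?connect1.
Qed.

End Runs.

(* The cut-out instance: only the labels seen by a run that has not left W are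
   kept, so every vertex near the cut has a hole nearby and is not verified. *)
Section Truncation.
Variables (R : realType) (Pi : lcl) (rho : nat) (M : mender R Pi rho).
Variables (G : sgraph) (lam : labeling (label Pi) G) (W A : {set G}).
Variable v : induced A.
Hypotheses (hrho1 : (1 <= rho)%N) (inst : instance lam (incl v)).
Hypotheses (vW : incl v \in W) (gA : grown (incl v) A).
Hypothesis sWA : ball rho.+1 W \subset A.

Definition truncate : labeling (label Pi) (induced A) :=
  [ffun x => if incl x \in ball rho W then lam (incl x) else None].

Lemma truncate_nbhd (x : induced A) :
  incl x \in ball rho W -> nbhd [set incl x] \subset A.
Proof.
by move=> xW; apply: subset_trans sWA; apply: nbhdS; rewrite sub1set.
Qed.

Lemma truncate_instance : instance truncate v.
Proof.
have [inG /partial_solutionP sol hv] := inst.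
have inH := in_class_induced gA inG.
split=> //; last by rewrite /hole ffunE (eqP hv) if_same.
apply/partial_solutionP => u defu.
(* A ball without holes lies in [ball rho W], away from the cut, so it is the same ball with the
   same labels in [G]. *)
have near x : x \in ball (radius Pi) [set u] -> incl x \in ball rho W.
  by move=> xu; have := defu x xu; rewrite ffunE; case: ifP.
have ballu : @incl _ A @: ball (radius Pi) [set u] =
    ball (radius Pi) [set incl u].
  rewrite incl_ball ?imset_set1 // => x xu; exact: truncate_nbhd (near x xu).
rewrite (@happy_local Pi (induced A) G truncate lam u (incl u) (@incl G A)) //.
  apply: sol => y; rewrite -ballu => /imsetP[x xu ->].
  by have := defu x xu; rewrite ffunE near.
split=> //; first by move=> x y _ _; apply: incl_inj.
by move=> x xu; rewrite ffunE near.
Qed.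

(** Locality along [incl]: the ball of radius [rho] around [U] lies in [ball rho W], whose labels
    are kept and whose neighbors are all in [A], so the mender sees the same picture in both
    graphs. *)
Lemma truncate_trans (U U' : {set G}) :
    U \subset W -> incl v \in U -> U' \subset nbhd U ->
  trans M truncate v (@incl _ A @^-1: U) (@incl _ A @^-1: U') =
  trans M lam (incl v) U U'.
Proof.
move=> sUW vU sU'.
have sball k : (k <= rho.+1)%N -> ball k U \subset A.
  move=> lek; apply: subset_trans sWA.
  by apply: subset_trans (ballS _ sUW) _; apply: leq_ball.
have sUA : U \subset A := sball 0%N isT.
have sU'A : U' \subset A by apply: subset_trans sU' (sball 1%N isT).
have near x : x \in ball rho (@incl _ A @^-1: U) -> incl x \in ball rho W.
  move=> xU; apply: (subsetP (ballS rho sUW)).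
  rewrite -(incl_preimset sUA); apply: (subsetP (incl_ball_sub _ _)).
  exact: imset_f.
have imball : @incl _ A @: ball rho (@incl _ A @^-1: U) = ball rho U.
  rewrite incl_ball ?incl_preimset // => x xU.
  exact: truncate_nbhd (near x xU).
rewrite (@locality R Pi rho M (induced A) G truncate lam v (incl v) (@incl _ A)
           (@incl _ A @^-1: U) U) ?inE //.
- by rewrite incl_preimset.
- exact: truncate_instance.
- split=> //; first by move=> x y _ _; apply: incl_inj.
  by move=> x xU; rewrite ffunE near.
- by rewrite incl_preimset.
- apply/subsetP => x; rewrite inE => xU'.
  have : incl x \in ball rho U.
    by apply: subsetP xU'; apply: subset_trans sU' (leq_ball U hrho1).
  by rewrite -imball (mem_imset _ _ (@incl_inj _ _)).
Qed.

Lemma truncate_connect (U : {set G}) :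
    incl v \in U -> connect (moves M lam (incl v)) U W ->
  connect (moves M truncate v) (@incl _ A @^-1: U) (@incl _ A @^-1: W).
Proof.
move=> vU /connectP[p]; elim: p U vU => [U _ _ -> //|V p IHp U vU] /=.
move=> /andP[UV pV] defW.
have sUV := progress inst UV; have vV := subsetP sUV _ vU.
have sVW : V \subset W.
  by apply: (@moves_sub _ _ _ M _ _ _ inst); apply/connectP; exists p.
apply: connect_trans (connect1 _) (IHp V vV pV defW).
rewrite /moves truncate_trans ?(subset_trans sUV) //.
exact: (exploration inst vU UV).
Qed.

(** The step to [W'] starts at [W], so it is still reproduced. Afterwards the two runs may diverge,
    but states only grow. *)
Lemma truncate_DMVol (W' : {set G}) :
    connect (moves M lam (incl v)) [set incl v] W -> moves M lam (incl v) W W' ->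
  (#|W'| <= DMVol M (induced A))%N.
Proof.
move=> runW WW'; have sW' := exploration inst vW WW'.
have sW'A : W' \subset A.
  apply: subset_trans sW' _; apply: subset_trans sWA.
  by apply: (leq_ball W (_ : (1 <= rho.+1)%N)).
rewrite -(incl_preimset sW'A) (card_imset _ (@incl_inj _ _)).
apply: (leq_DMVol truncate_instance).
have -> : [set v] = @incl _ A @^-1: [set incl v].
  by apply/setP => x; rewrite !inE (inj_eq (@incl_inj _ _)).
apply: connect_trans (truncate_connect (set11 _) runW) (connect1 _).
by rewrite /moves truncate_trans.
Qed.

End Truncation.

(** * The dichotomy *)

Section PathGraph.
Local Open Scope nat_scope.
Variable n : nat.

Definition path_adj : rel 'I_n :=
  fun i j => (j == i.+1 :> nat) || (i == j.+1 :> nat).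

Fact path_adj_sym : symmetric path_adj.
Proof. by move=> i j; rewrite /path_adj orbC. Qed.

Fact path_adj_irrefl : irreflexive path_adj.
Proof. by move=> i; rewrite /path_adj orbb; apply/eqP; lia. Qed.

Definition path_graph : sgraph := SGraph path_adj_sym path_adj_irrefl.

Lemma path_graph_path : 0 < n -> is_path path_graph.
Proof.
move=> n_gt0; split; first by rewrite card_ord.
exists (cast_ord (esym (card_ord n))); split=> //.
by exists (cast_ord (card_ord n)); move=> i; apply: val_inj.
Qed.

Lemma path_graph_tree : 0 < n -> is_tree path_graph.
Proof.
move=> n_gt0; split; first by rewrite card_ord.
  pose o : path_graph := Ordinal n_gt0.
  have conn0 (x : path_graph) : connect (@adj path_graph) o x.
    case: x => k; elim: k => [|k IHk] ltk.
      by rewrite (_ : Ordinal ltk = o) ?connect0 //; apply: val_inj.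
    apply: connect_trans (IHk (ltnW ltk)) (connect1 _).
    by rewrite /= /path_adj /= eqxx.
  move=> x y; apply: (@connect_trans _ _ o) (conn0 y).
  by rewrite (sym_connect_sym (@adj_sym path_graph)).
(* Both neighbors on a cycle of its largest vertex m would be m - 1. *)
case=> [//|x0 c0] szc /andP[cyc uc].
case: (@arg_maxnP _ x0 (fun x => x \in x0 :: c0) val) => [|m mc maxm].
  exact: mem_head.
have [i c defc] := rot_to mc.
move: cyc uc; rewrite -(rot_cycle i) -(rot_uniq i) defc.
have memc y : y \in m :: c -> (y <= m)%N.
  by rewrite -defc mem_rot; apply: maxm.
have : 2 < size (m :: c) by rewrite -defc size_rot.
case: c {defc} memc => [//|a c]; case/lastP: c => [//|c b] memc _.
rewrite /= rcons_path last_rcons => /andP[ma /andP[_ bm]].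
rewrite mem_rcons !inE => /and3P[_ /norP[/eqP neab _] _].
case: neab; apply: val_inj.
have lea : (a <= m)%N by apply: memc; rewrite !inE eqxx orbT.
have leb : (b <= m)%N by apply: memc; rewrite !inE mem_rcons inE eqxx !orbT.
by move: ma bm => /= /orP[]/eqP ? /orP[]/eqP ?; lia.
Qed.

End PathGraph.

Definition edgeless_graph (n : nat) : sgraph :=
  @SGraph 'I_n (fun _ _ => false) (fun _ _ => erefl) (fun _ => erefl).

(** A tree of maximum degree at most 1 has at most two vertices, whence the condition on [Trees].
    For [Graphs D] the edgeless graph fits even [D = 0]. *)
Lemma in_class_exists C n :
    (forall D, C = Trees D -> (2 <= D)%N) -> (0 < n)%N ->
  exists2 G : sgraph, in_class C G & #|G| = n.
Proof.
move=> htrees n_gt0; have pathP := path_graph_path n_gt0.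
case: C htrees => [|D|D] htrees.
- by exists (path_graph n); rewrite ?card_ord.
- exists (path_graph n); rewrite ?card_ord //; split; first exact: path_graph_tree.
  by move=> x; apply: leq_trans (htrees D erefl); apply: in_class_degree Paths _ _ x.
- exists (edgeless_graph n); rewrite ?card_ord // => x.
  by rewrite (@eq_card0 _ _) // => y; rewrite inE.
Qed.

Section Dichotomy.
Variables (R : realType) (Pi : lcl) (rho : nat).
Hypotheses (hmend : mends_exist Pi).
Hypotheses (hrho1 : (1 <= rho)%N) (hrho : (2 * radius Pi <= rho)%N).

Local Notation bfs := (@bfs_mender R Pi rho hmend hrho1 hrho).

(** With every vertex a hole, the labeling is vacuously a partial solution, and the starting state
    already has one vertex. *)
Lemma DMVol_Omega1 :
    (forall D : nat, class Pi = Trees D -> (2 <= D)%N) ->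
  @DMVol_Omega R Pi rho (fun _ => 1).
Proof.
move=> htrees M; exists 1; first exact: ltr01.
exists 1%N => n n_gt0; have [G inG cardG] := in_class_exists htrees n_gt0.
exists G; split=> //; rewrite mulr1 ler1n.
have /card_gt0P[v _] : (0 < #|G|)%N by rewrite cardG.
pose lam : labeling (label Pi) G := [ffun=> None].
have inst : instance lam v.
  split=> //; last by rewrite /hole ffunE.
  apply/partial_solutionP => u /(_ u (ball_refl _ u)).
  by rewrite ffunE.
by rewrite -(cards1 v); apply: (leq_DMVol inst); apply: connect0.
Qed.

Lemma DMVol_le_card (M : mender R Pi rho) (G : sgraph) : (DMVol M G <= #|G|)%N.
Proof.
apply/bigmax_leqP => lam _; apply/bigmax_leqP => v _; apply/bigmax_leqP => W _.
exact: max_card.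
Qed.

Lemma bfs_DMVol (k D : nat) (G : sgraph) :
    in_class (class Pi) G -> max_degree_le D G ->
    (forall (lam : labeling (label Pi) G) (v : G), instance lam v ->
       contains_mend lam v (ball k [set v])) ->
  (DMVol bfs G <= D.+1 ^ k)%N.
Proof.
move=> inG degG easy; apply/bigmax_leqP => lam sol; apply/bigmax_leqP => v hv.
have inst : instance lam v by [].
apply/bigmax_leqP => W; rewrite inE => /andP[/connectP[p pW defW] _].
have [j lejk ->] : exists2 j, (j <= k)%N & W = ball j [set v].
  rewrite {}defW; suff: forall i, path (moves bfs lam v) (ball i [set v]) p ->
      (i <= k)%N -> exists2 j, (j <= k)%N & last (ball i [set v]) p = ball j [set v].
    by move/(_ 0%N pW isT).
  elim: p {pW} => [|U p IHp] j /=; first by move=> _ lejk; exists j.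
  rewrite [moves _ _ _ _ _]bfs_trans_gt0 /bfs_step => /andP[/eqP->].
  case: ifPn => [_|nomend]; first exact: IHp.
  (* At [j = k] the ball contains a mend by assumption, so a further step occurs only for
     [j < k]. *)
  rewrite leq_eqVlt => pU /predU1P[defj|]; last exact: IHp j.+1 pU.
  by case/negP: nomend; rewrite defj; apply: easy.
apply: leq_trans (card_ball j _ degG) _; rewrite cards1 muln1.
exact: leq_pexp2l.
Qed.

Lemma linear_DMVol_Omega :
    (forall k, exists (G : sgraph) (lam : labeling (label Pi) G) (v : G),
       instance lam v /\ ~~ contains_mend lam v (ball k [set v])) ->
  @DMVol_Omega R Pi rho (fun n => n%:R).
Proof.
move=> hard M; pose D := degree_bound (class Pi); pose C := (D.+1 ^ rho.+1)%N.
have C_gt0 : (0 < C)%N by rewrite expn_gt0.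
(* A state with more than [k = n %/ C] vertices has more than [n / C] of them. The threshold [C]
   makes [k] positive, so that the starting state has size at most [k]. *)
exists C%:R^-1; first by rewrite invr_gt0 ltr0n.
exists C => n leCn; have [G [lam [v [inst nomend]]]] := hard n.
have [inG _ _] := inst; have degG := in_class_degree inG.
have small W : grown v W -> (#|W| <= n)%N -> ~~ contains_mend lam v W.
  move=> gW leWn; apply: contra nomend; apply: contains_mendS.
  exact: subset_trans (grown_sub_ball gW) (leq_ball _ leWn).
(* A grown set without outside neighbors would be the whole component of [v] and hence contain a
   mend, contradicting [small]. *)
have open W : grown v W -> (#|W| < n)%N -> nbhd W != W.
  move=> gW /ltnW/(small W gW); apply: contra => /eqP clW.
  exact: contains_mend_closed hmend inst (grown_mem gW) clW.
pose k := (n %/ C)%N.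
have k_gt0 : (0 < k)%N by rewrite divn_gt0.
have [W [W' [vW leWk WW' ltkW']]] : exists W W',
    [/\ connect (moves M lam v) [set v] W, (#|W| <= k)%N, moves M lam v W W'
      & (k < #|W'|)%N].
  apply: (moves_cross M inst k_gt0) => W gW leWk; apply: small gW _.
  exact: leq_trans leWk (leq_div _ _).
have gW := moves_grown inst vW (grown1 v).
have [||A gA [sWA cardA]] := @grown_extend G v n (ball rho.+1 W) open.
- exact: grown_ball.
- apply: leq_trans (card_ball _ _ degG) _.
  apply: leq_trans (leq_trunc_div n C); rewrite mulnC leq_mul2r.
  by rewrite leWk orbT.
have /inclP[u defv] := grown_mem gA; subst v.
exists (induced A); split; first exact: in_class_induced gA inG.
  by rewrite card_induced.
have leD := truncate_DMVol hrho1 inst (grown_mem gW) gA sWA vW WW'.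
rewrite mulrC ler_pdivrMr ?ltr0n // -natrM ler_nat.
by rewrite ltnW // -ltn_divLR // (leq_trans ltkW').
Qed.

End Dichotomy.

Theorem theoremB2 (R : realType) (Pi : lcl) (rho : nat)
  (htrees : forall D : nat, class Pi = Trees D -> (2 <= D)%N)
  (hmend : mends_exist Pi)
  (hrho1 : (1 <= rho)%N) (hrho : (2 * radius Pi <= rho)%N) :
  @DMVol_Theta R Pi rho (fun _ => 1) \/ @DMVol_Theta R Pi rho (fun n => n%:R).
Proof.
pose easy k := forall (G : sgraph) (lam : labeling (label Pi) G) (v : G),
  instance lam v -> contains_mend lam v (ball k [set v]).
have [[k easyk]|hard] := EM (exists k, easy k); [left|right]; split.
- exists (bfs_mender R hmend hrho1 hrho).
  exists ((degree_bound (class Pi)).+1 ^ k)%N%:R, 0%N => G inG _.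
  rewrite mulr1 ler_nat; apply: bfs_DMVol (in_class_degree inG) _ => //.
  exact: easyk.
- exact: DMVol_Omega1.
(* The linear upper bound holds for every mender; the breadth-first one only witnesses that a mender
   exists. *)
- exists (bfs_mender R hmend hrho1 hrho), 1, 0%N => G _ _.
  by rewrite mul1r ler_nat DMVol_le_card.
- apply: linear_DMVol_Omega => // k; apply: contrapT => nok.
  apply: hard; exists k => G lam v inst; apply: contraT => nomend.
  by case: nok; exists G, lam, v.
Qed.
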